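(* Let $d\ge 3$ and $n\ge 1$ be integers, let $G$ be a forest on the vertex set $[n]=\{1,\ldots,n\}$, and let $S$ be a $G$-admissible subset of $[n]$. Then $$\dim(V_S)=d\,(n-|S|)-|E(G_{[n]\setminus S})|.$$
   Context: A forest is a finite simple graph without cycles. $E(G)$ is the edge set, $N_G(i)$ the set of neighbors of $i$ in $G$, and $G_{[n]\setminus S}$ the subgraph of $G$ induced on $[n]\setminus S$. For $v,w\in\mathbb{C}^d$ put $v\cdot w=\sum_{k=1}^d v_kw_k$ (bilinear product). The variety $\mathrm{OR}_d(\overline{G})\subset(\mathbb{C}^d)^n$ is the set of all tuples $(v_1,\ldots,v_n)$ with $v_i\cdot v_j=0$ whenever $\{i,j\}\in E(G)$. For $S\subseteq[n]$, $U(S)$ is the set of all $(v_1,\ldots,v_n)\in\mathrm{OR}_d(\overline{G})$ such that $v_i=0$ if and only if $i\in S$, and $V_S=\overline{U(S)}$ is its Zariski closure in $\mathbb{C}^{nd}$. A subset $S\subseteq[n]$ is $G$-admissible if for every $i\in S$: $|N_G(i)\cap([n]\setminus S)|\ge d$, and $N_G(i)\cap([n]\setminus S)\not\subseteq N_G(j)\cap([n]\setminus S)$ for every $j\in[n]\setminus S$. *)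

(* Defs.v *)
(* MathComp; the complex numbers are R[i] for R : realType. *)
From mathcomp Require Import all_boot all_order all_algebra.
From mathcomp Require Import complex.
From mathcomp Require Import mpoly.
From mathcomp Require Import classical_sets reals.

Set Implicit Arguments.
Unset Strict Implicit.
Unset Printing Implicit Defensive.

Import GRing.Theory.
Local Open Scope ring_scope.

Section Zariski.
Local Open Scope classical_set_scope.
Variables (K : fieldType) (m n : nat).
Implicit Types (X Z W : set 'M[K]_(m, n)).

(* A point of affine (m * n)-space is an m x n matrix, and mxvec lists its
   entries as the values of the m * n variables. *)
Definition mxeval (p : {mpoly K[m * n]}) (v : 'M[K]_(m, n)) : K :=
  p.@[fun k => mxvec v ord0 k].

Definition zariski_closed Z : Prop :=
  exists P : set {mpoly K[m * n]},
    Z = [set v | forall p, P p -> mxeval p v = 0].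

Definition zariski_closure X : set 'M[K]_(m, n) := smallest zariski_closed X.

Definition zariski_closed_in X Z : Prop :=
  exists2 W, zariski_closed W & Z = X `&` W.

(* Irreducibility of Z for the topology induced on Z. *)
Definition zariski_irreducible Z : Prop :=
  Z !=set0 /\
  forall W1 W2, zariski_closed W1 -> zariski_closed W2 ->
    Z `<=` W1 `|` W2 -> Z `<=` W1 \/ Z `<=` W2.

(* Z 0 < Z 1 < ... < Z l ; the values Z i for i > l are irrelevant. *)
Definition irreducible_chain X (l : nat) (Z : nat -> set 'M[K]_(m, n)) : Prop :=
  (forall i, (i <= l)%N -> zariski_closed_in X (Z i) /\ zariski_irreducible (Z i))
  /\ (forall i, (i < l)%N -> Z i `<` Z i.+1).

(* The Krull dimension of the space X, i.e. the supremum of the lengths of its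
   chains of irreducible closed subsets, is the natural number D. *)
Definition has_dimension X (D : nat) : Prop :=
  (exists Z : nat -> set 'M[K]_(m, n), irreducible_chain X D Z) /\
  (forall l (Z : nat -> set 'M[K]_(m, n)), irreducible_chain X l Z -> (l <= D)%N).

End Zariski.

Section Graph.
Variables (T : finType) (e : rel T).

Definition simple_graph : Prop := ssrbool.symmetric e /\ irreflexive e.

(* In a simple graph, [:: x; y] with e x y satisfies ucycle but only traverses
   one edge back and forth; genuine cycles have at least three vertices. *)
Definition forest : Prop :=
  simple_graph /\ ~ exists c : seq T, ucycle e c /\ (2 < size c)%N.

Definition neighbors (x : T) : {set T} := [set y | e x y].

Definition edges : {set {set T}} := [set [set x; y] | x in T, y in neighbors x].

(* The induced subgraph on A is kept on the same vertex type: vertices outside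
   A become isolated, which does not affect the edge set. *)
Definition induced (A : {set T}) : rel T :=
  fun x y => [&& x \in A, y \in A & e x y].

Definition admissible (d : nat) (S : {set T}) : Prop :=
  forall x, x \in S ->
    (d <= #|neighbors x :&: ~: S|)%N /\
    forall y, y \in ~: S ->
      ~~ (neighbors x :&: ~: S \subset neighbors y :&: ~: S).

End Graph.

Section OrthogonalRepresentations.
Local Open Scope classical_set_scope.
Variables (K : fieldType) (n d : nat) (e : rel 'I_n).

(* Bilinear: no complex conjugation. *)
Definition dotv (v w : 'rV[K]_d) : K := \sum_(k < d) v ord0 k * w ord0 k.

(* The tuple (v_1, ..., v_n) is the matrix with rows v_i. The argument e is the
   graph G whose edges impose orthogonality, so this is OR_d of the complement
   of e. *)
Definition OR : set 'M[K]_(n, d) :=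
  [set v | forall i j, e i j -> dotv (row i v) (row j v) = 0].

Definition Uset (S : {set 'I_n}) : set 'M[K]_(n, d) :=
  [set v | OR v /\ forall i, row i v = 0 <-> i \in S].

Definition Vset (S : {set 'I_n}) : set 'M[K]_(n, d) := zariski_closure (Uset S).

End OrthogonalRepresentations.

(* Main.v *)
(* Only the vertices outside S matter. Order them so that each has at most one
   earlier neighbor, its parent; the number of edges is the number of vertices
   that have a parent. A row v_c orthogonal to the row v_p of its parent is
   v_p A with A antisymmetric, and if the k0-th entry of v_p is nonzero one may
   take A = e^T w - w^T e, with e the k0-th unit row and w a unique row with
   w_k0 = 0. This gives a polynomial map F from affine D-space, where D is the
   expected dimension, whose image contains all points of U(S) with nonzero k0-th
   entries outside S. Interpolating linearly the parent-to-child matrices between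
   those of an arbitrary point of U(S) and those of a point with all rows
   (1, i, 0, ...) yields a polynomial curve; so V_S is the closure of the image
   of F.

   Upper bound: a chain of length l gives l polynomials that are algebraically
   independent on V_S, and their pullbacks along F are l polynomials in D
   variables, so l <= D. Lower bound: take the closures of the images of a flag
   of affine subspaces through a point where F is generically injective. *)
Require Import Defs.
From mathcomp Require Import all_boot all_order all_algebra.
From mathcomp Require Import complex.
From mathcomp Require Import mpoly.
From mathcomp Require Import boolp.
From mathcomp Require Import classical_sets reals.
Set Implicit Arguments.
Unset Strict Implicit.
Unset Printing Implicit Defensive.
Import Order.TTheory GRing.Theory Num.Theory.

(** * Forests *)

Section Forest.
Variables (T : finType) (e : rel T).
Hypothesis he : forest e.

(* Otherwise a path in A could be prolonged forever without repetition. *)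
Lemma forest_leaf (A : {set T}) : A != finset.set0 ->
  exists2 x, x \in A & (#|neighbors e x :&: A| <= 1)%N.
Proof.
case: he => [[esym eirr] acyc] /finset.set0Pn[x0 x0A].
apply/exists_inP; apply: contraT; rewrite negb_exists_in => /forall_inP noleaf.
suff long k : exists x p, [/\ size p = k, path e x p, uniq (x :: p) & x \in A].
  have [x [p [sp _ /card_uniqP up _]]] := long #|T|.
  by have := max_card (mem (x :: p)); rewrite up /= sp ltnn.
elim: k => [|k [x [p [sp ep up xA]]]]; first by exists x0, [::].
have := noleaf x xA; rewrite -ltnNge => /card_gt1P[y [z [yN zN yz]]].
(* Avoiding the vertex after [x] keeps the prolongation from turning back; for a one-vertex path
   [head x p] is [x] itself. *)
have [w [wN wh]] : exists w, w \in neighbors e x :&: A /\ w != head x p.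
  by have [yh|?] := eqVneq y (head x p); [exists z; rewrite -yh eq_sym | exists y].
move: wN; rewrite !inE => /andP[exw wA].
have wx : w != x by apply: contraTneq exw => ->; rewrite eirr.
have [wp|wp] := boolP (w \in p); last first.
  exists w, (x :: p); rewrite /= esym exw ep sp; split=> //.
  by rewrite inE negb_or wx wp.
(* Since [w] is on the path but not next to [x] along it, the segment from [x] to [w] closes to a
   cycle with at least three vertices. *)
case: acyc; case/splitPr: wp wh ep up {sp} => [[|z1 p1] p2] /=.
  by rewrite eqxx.
move=> wz1 /andP[ez1]; rewrite cat_path /= => /and3P[ep1 ew _] /=.
move=> up.
exists (x :: z1 :: rcons p1 w); split=> //; last by rewrite /= size_rcons.
apply/andP; split=> /=.
  by rewrite ez1 !rcons_path ep1 ew /= last_rcons esym.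
have {}up : uniq (x :: z1 :: p1 ++ w :: p2) := up.
change (uniq (x :: z1 :: rcons p1 w)).
by apply: (subseq_uniq _ up); rewrite -cat_rcons /= !eqxx prefix_subseq.
Qed.

(** A vertex with at most one neighbor in [A] is removed and the rest is rooted by induction. That
    neighbor, if any, becomes its parent, and its new rank exceeds all others. *)
Lemma forest_parent (A : {set T}) :
  exists (par : T -> option T) (rk : T -> nat),
    (forall x y, par x = Some y -> [/\ x \in A, y \in A, e x y & (rk y < rk x)%N]) /\
    (forall x y, x \in A -> y \in A -> e x y -> par x = Some y \/ par y = Some x).
Proof.
case: (he) => [[esym eirr] _].
elim: {A}_.+1 {-2}A (ltnSn #|A|) => // k IH A Ak.
have [->|A0] := eqVneq A finset.set0.
  by exists (fun=> None), (fun=> 0); split=> // x y; rewrite inE.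
have [x xA xN] := forest_leaf A0.
have [|par [rk [h1 h2]]] := IH (A :\ x).
  by move: Ak; rewrite (cardsD1 x A) xA.
pose q := [pick y in neighbors e x :&: A].
exists (fun z => if z == x then q else par z).
exists (fun z => if z == x then (\max_y rk y).+1 else rk z).
split=> y z.
  case: (eqVneq y x) => [->|yx].
    rewrite /q; case: pickP => // w; rewrite !inE => /andP[exw wA] [<-].
    have /negbTE -> : w != x by apply: contraTneq exw => ->; rewrite eirr.
    by split=> //; rewrite ltnS (leq_bigmax w).
  by move=> /h1[]; rewrite !inE => /andP[_ ->] /andP[/negbTE -> ->].
have nx w : w \in A -> e x w -> q = Some w.
  move=> wA xw; have wN : w \in neighbors e x :&: A by rewrite !inE xw.
  rewrite /q; case: pickP => [w' w'N|/(_ w)]; last by rewrite wN.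
  by congr Some; apply/(card_le1_eqP xN).
move=> yA zA yz; case: (eqVneq y x) => [yx|yx].
  by left; apply: nx; rewrite -?yx.
case: (eqVneq z x) => [zx|zx]; first by right; apply: nx; rewrite -?zx // esym.
by apply: h2; rewrite // !inE ?yx ?zx.
Qed.

(** Edges correspond to non-roots by sending x to {x, par x}. Two vertices with the same edge would
    be parents of each other, which the ranks forbid. *)
Lemma card_edges_parent (A : {set T}) (par : T -> option T) (rk : T -> nat) :
    (forall x y, par x = Some y -> [/\ x \in A, y \in A, e x y & (rk y < rk x)%N]) ->
    (forall x y, x \in A -> y \in A -> e x y -> par x = Some y \/ par y = Some x) ->
  #|edges (induced e A)| = #|[set x | par x != None]|.
Proof.
move=> h1 h2.
pose f x := [set x; odflt x (par x)].
have -> : edges (induced e A) = [set f x | x in [set x | par x != None]].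
  apply/finset.setP=> E; apply/imset2P/imsetP.
    case=> x y _; rewrite inE => /and3P[xA yA xy] ->.
    case: (h2 _ _ xA yA xy) => h; [exists x|exists y]; rewrite ?inE ?h /f ?h //=.
    by rewrite finset.setUC.
  case=> x; rewrite inE /f; case h : (par x) => [y|//] _ -> /=.
  by have [? ? ? _] := h1 _ _ h; exists x y; rewrite // inE; apply/and3P.
rewrite card_in_imset // => x y; rewrite !inE /f.
case hx : (par x) => [x'|//] _; case hy : (par y) => [y'|//] _ /= /finset.setP E.
have [_ _ _ rx] := h1 _ _ hx; have [_ _ _ ry] := h1 _ _ hy.
have := E x; have := E y; rewrite !inE !eqxx /=.
case: (eqVneq x y) => [//|xy] /=.
move=> /eqP yx' /esym/eqP xy'.
by move: rx ry; rewrite -yx' -xy' => /ltnW; rewrite leqNgt => /negbTE ->.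
Qed.

End Forest.

Local Open Scope ring_scope.

(** * Algebraic dependence *)

Section Mpoly.
Variable K : fieldType.

Lemma muni_eval l (p : {mpoly K[l.+1]}) (v : 'I_l.+1 -> K) :
  p.@[v] = (map_poly (meval (fun i => v (widen_ord (leqnSn l) i))) (muni p)).[v ord_max].
Proof.
rewrite muniE raddf_sum /= horner_sum mevalE; apply: eq_bigr => m _.
rewrite -mul_polyC rmorphM /= map_polyC map_polyXn /= mevalZ mevalX hornerCM hornerXn.
rewrite big_ord_recr /= mulrA; congr (_ * _ * _).
by apply: eq_bigr => i _; rewrite mnmE.
Qed.

Lemma muni_eq0 l (p : {mpoly K[l.+1]}) : muni p = 0 -> p = 0.
Proof.
move=> p0; suff -> : p = (map_poly (@mwiden l K) (muni p)).['X_ord_max].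
  by rewrite p0 rmorph0 horner0.
rewrite muniE raddf_sum /= horner_sum [LHS]mpolyE; apply: eq_bigr => m _.
rewrite -!mul_polyC !rmorphM /= !map_polyC map_polyXn /= mwidenZ.
rewrite hornerCM hornerXn -scalerAl; congr (_ *: _).
rewrite /mwiden mmapX /mmap1 [LHS]mpolyXE_id big_ord_recr /=; congr (_ * _).
by apply: eq_bigr => i _; rewrite mnmE.
Qed.

Lemma meval_comp n k (p : {mpoly K[n]}) (P : 'I_n -> {mpoly K[k]}) (u : 'I_k -> K) :
  (mmap (@mpolyC k K) P p).@[u] = p.@[fun i => (P i).@[u]].
Proof.
rewrite [RHS]mevalE /mmap raddf_sum /=; apply: eq_bigr => m _.
rewrite rmorphM /= mevalC /mmap1 rmorph_prod /=; congr (_ * _).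
by apply: eq_bigr => i _; rewrite rmorphXn.
Qed.

Lemma horner_mmap n (p : {mpoly K[n]}) (P : 'I_n -> {poly K}) (t : K) :
  (mmap polyC P p).[t] = p.@[fun i => (P i).[t]].
Proof.
rewrite mevalE /mmap horner_sum /=; apply: eq_bigr => m _.
rewrite hornerM hornerC /mmap1 horner_prod; congr (_ * _).
by apply: eq_bigr => i _; rewrite horner_exp.
Qed.

(** [msize] is the total degree plus one, and 0 for the zero polynomial; the successors turn the
    bounds into degree bounds. *)
Lemma msizeM_leS n (p q : {mpoly K[n]}) (a b : nat) :
  (msize p <= a.+1 -> msize q <= b.+1 -> msize (p * q) <= (a + b).+1)%N.
Proof.
have [->|p0] := eqVneq p 0; first by rewrite mul0r msize0.
have [->|q0] := eqVneq q 0; first by rewrite mulr0 msize0.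
by move=> pa qb; rewrite msizeM // -subn1 leq_subLR -addSn add1n -addnS leq_add.
Qed.

Lemma msize_exp_leS n (p : {mpoly K[n]}) (a k : nat) :
  (msize p <= a.+1 -> msize (p ^+ k) <= (k * a).+1)%N.
Proof.
move=> pa; elim: k => [|k IH]; first by rewrite msize1.
by rewrite exprS mulSn; apply: msizeM_leS.
Qed.

(* The s ^ l products of powers < s of the P i have degree O(s), hence lie in a
   space of dimension O(s ^ D), which is smaller than s ^ l for s large. *)
Lemma alg_dependent l D (P : 'I_l -> {mpoly K[D]}) : (D < l)%N ->
  exists2 Q : {mpoly K[l]}, Q != 0 & mmap (@mpolyC D K) P Q = 0.
Proof.
move=> Dl; set C := \sum_i msize (P i).
(* Here B <= s (C + 1), so B^D <= (C + 1)^D s^D < s^(D + 1) <= s^l. *)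
pose s := (((C.+1) ^ D).+1)%N; pose B := (s * C).+1.
pose mon k t (a : {ffun 'I_k -> 'I_t}) := [multinom a i : nat | i < k].
have mon_inj k t : injective (@mon k t).
  move=> a b ab; apply/ffunP=> i; apply: val_inj.
  by move/mnmP/(_ i): ab; rewrite !mnmE.
pose P_ a := mmap (@mpolyC D K) P 'X_[@mon l s a].
have szP a : (msize (P_ a) <= B)%N.
  rewrite /P_ mmapX /mmap1.
  have h (r : seq 'I_l) :
    (msize (\prod_(i <- r) P i ^+ (@mon l s a) i) <= (\sum_(i <- r) s * msize (P i)).+1)%N.
    elim: r => [|i r IH]; first by rewrite !big_nil msize1.
    rewrite !big_cons; apply: msizeM_leS => //.
    apply: leq_trans (msize_exp_leS _ (leqnSn _)) _.
    by rewrite ltnS leq_mul2r mnmE ltnW ?orbT.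
  by apply: leq_trans (h _) _; rewrite /B /C big_distrr.
pose M : 'M[K]_(#|{ffun 'I_l -> 'I_s}|, #|{ffun 'I_D -> 'I_B}|) :=
  \matrix_(i, j) (P_ (enum_val i))@_(mon D B (enum_val j)).
(* Rows of [M] are coefficient vectors of the power products; having more rows than columns, [M]
   yields a linear relation [c] between them. *)
have /rowV0Pn[c /sub_kermxP cM c0] : kermx M != 0.
  rewrite kermx_eq0 /row_free neq_ltn; apply/orP; left.
  apply: leq_ltn_trans (rank_leq_col _) _; rewrite !card_ffun !card_ord.
  apply: leq_ltn_trans (_ : ((C.+1 * s) ^ D < _)%N).
    have [->|D0] := posnP D; first by rewrite !expn0.
    by rewrite leq_exp2r // /B mulSn mulnC -add1n leq_add2r.
  rewrite expnMn; apply: (@leq_trans (s ^ D.+1)); last by rewrite leq_pexp2l.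
  by rewrite expnS ltn_mul2r expn_gt0 /s ltnSn.
pose Q := \sum_i c 0 i *: 'X_[mon l s (enum_val i)] : {mpoly K[l]}.
exists Q.
  apply: contra_neq c0 => Q0; apply/rowP=> i; rewrite mxE.
  have /(congr1 (mcoeff (mon l s (enum_val i)))) := Q0.
  rewrite mcoeff0 /Q raddf_sum /= (bigD1 i) //= mcoeffZ mcoeffX eqxx mulr1.
  rewrite big1 ?addr0 // => j ji; rewrite mcoeffZ mcoeffX.
  by rewrite (inj_eq (mon_inj _ _)) (inj_eq enum_val_inj) (negbTE ji) mulr0.
have QE : mmap (@mpolyC D K) P Q = \sum_i c 0 i *: P_ (enum_val i).
  by rewrite raddf_sum; apply: eq_bigr => i _; rewrite /= mmapZ mul_mpolyC.
apply/mpolyP=> m; rewrite mcoeff0.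
(* A monomial with some exponent at least [B] has too large a degree to occur in any power product;
   all others are columns of [M]. *)
have [mB|mB] := boolP [forall i, m i < B]%N; last first.
  rewrite QE raddf_sum /= big1 // => i _; rewrite mcoeffZ.
  rewrite [X in _ * X](_ : _ = 0) ?mulr0 //; apply/eqP; rewrite mcoeff_eq0.
  apply: contra mB => /msize_mdeg_lt mP; apply/forallP=> j.
  apply: leq_ltn_trans (leq_trans mP (szP _)).
  by rewrite mdegE (bigD1 j) //= leq_addr.
pose b := [ffun i => Ordinal (forallP mB i)].
have -> : m = mon D B b by apply/mnmP=> i; rewrite !mnmE ffunE.
transitivity ((c *m M) 0 (enum_rank b)); last by rewrite cM mxE.
rewrite QE raddf_sum mxE; apply: eq_bigr => i _.
by rewrite /= mcoeffZ mxE enum_rankK.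
Qed.

End Mpoly.

(** * Chains of irreducible closed sets *)

Section Dimension.
Local Open Scope classical_set_scope.
Variable K : numFieldType.

(** In characteristic 0 the integers 0, 1, 2, ... supply more distinct roots than the degree
    allows. *)
Lemma horner_eq0 (p : {poly K}) : (forall t, p.[t] = 0) -> p = 0.
Proof.
move=> p0; apply: (@roots_geq_poly_eq0 _ _ [seq i%:R | i <- iota 0 (size p)]).
- by apply/allP=> x _; apply/rootP.
- by rewrite map_inj_uniq ?iota_uniq // => i j /eqP; rewrite eqr_nat => /eqP.
- by rewrite size_map size_iota.
Qed.

(** Restrict to the line through [u] (t = 0) and [b] (t = 1): the product is zero in the domain
    [{poly K}], and the restriction of [Q] is nonzero at t = 1. *)
Lemma meval_mul_eq0 D (P Q : {mpoly K[D]}) (b : 'I_D -> K) :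
    (forall u, P.@[u] * Q.@[u] = 0) -> Q.@[b] != 0 -> forall u, P.@[u] = 0.
Proof.
move=> PQ Qb u; pose L i : {poly K} := (u i)%:P + (b i - u i) *: 'X.
have : mmap polyC L P * mmap polyC L Q = 0.
  by apply: horner_eq0 => t; rewrite hornerM !horner_mmap.
move/eqP; rewrite mulf_eq0 => /orP[] /eqP L0.
  have := horner_mmap P L 0; rewrite L0 horner0 => ->.
  by apply: meval_eq => i; rewrite !hornerE.
case/eqP: Qb; have := horner_mmap Q L 1; rewrite L0 horner0 => ->.
by apply: meval_eq => i; rewrite /L hornerD hornerC hornerZ hornerX mulr1 addrC subrK.
Qed.

(** * Zariski closures and images of polynomial maps *)

Variables m n : nat.
Implicit Types (X Z U : set 'M[K]_(m, n)) (p q : {mpoly K[m * n]}).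

Lemma zariski_closureP X v :
  zariski_closure X v <-> forall p, (forall x, X x -> mxeval p x = 0) -> mxeval p v = 0.
Proof.
split=> [Xv p pX|h W [[P ->] XP] p Pp]; last by apply: h => x /XP; apply.
apply: (Xv [set x | mxeval p x = 0]); split=> [|x /pX //].
by exists [set p]; apply/seteqP; split=> x /= => [? _ ->|]; last exact.
Qed.

Lemma zariski_closed_closure X : zariski_closed (zariski_closure X).
Proof.
exists [set p | forall x, X x -> mxeval p x = 0].
by apply/seteqP; split=> v /zariski_closureP.
Qed.

Lemma sub_zariski_closure X : X `<=` zariski_closure X.
Proof. by move=> x Xx; apply/zariski_closureP => p; apply. Qed.

Lemma zariski_irreducible_mul Z p q : zariski_irreducible Z ->
    (forall v, Z v -> mxeval p v * mxeval q v = 0) ->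
  (forall v, Z v -> mxeval p v = 0) \/ (forall v, Z v -> mxeval q v = 0).
Proof.
have cl (r : {mpoly K[m * n]}) : zariski_closed [set v : 'M[K]_(m, n) | mxeval r v = 0].
  by exists [set r]; apply/seteqP; split=> x /= => [? _ ->|]; last exact.
case=> _ irr pq; have [|h|h] := irr _ _ (cl p) (cl q); [|by left|by right].
by move=> v /pq /eqP; rewrite mulf_eq0 => /orP[] /eqP; [left|right].
Qed.

Definition polymap D (F : 'M[{mpoly K[D]}]_(m, n)) (u : 'I_D -> K) : 'M[K]_(m, n) :=
  map_mx (meval u) F.

Definition pullback D (F : 'M[{mpoly K[D]}]_(m, n)) p : {mpoly K[D]} :=
  mmap (@mpolyC D K) (fun k => mxvec F ord0 k) p.

Lemma mxeval_polymap D (F : 'M[{mpoly K[D]}]_(m, n)) p u :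
  mxeval p (polymap F u) = (pullback F p).@[u].
Proof.
by rewrite meval_comp /mxeval /polymap -map_mxvec; apply: meval_eq => k; rewrite mxE.
Qed.

(** If an equation [p1] of [W1] fails on the closure, its pullback is nonzero somewhere. Its product
    with the pullback of any equation of [W2] vanishes, so the latter vanishes. *)
Lemma range_irreducible D (F : 'M[{mpoly K[D]}]_(m, n)) :
  zariski_irreducible (zariski_closure (range (polymap F))).
Proof.
split; first by exists (polymap F (fun=> 0)); apply: sub_zariski_closure; exists (fun=> 0).
move=> _ _ [P1 ->] [P2 ->] ZW; set Z := zariski_closure _ in ZW *.
have [|/existsNP[v /not_implyP[Zv]]] := pselect (Z `<=` [set v | forall p, P1 p -> mxeval p v = 0]).
  by left.
move=> /existsNP[p1 /not_implyP[P1p p1v]]; right=> w Zw p2 P2p.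
move/zariski_closureP: Zw; apply => _ [u _ <-]; rewrite mxeval_polymap.
have [b p1b] : exists b, (pullback F p1).@[b] != 0.
  apply: contra_notP p1v => /forallNP h.
  move/zariski_closureP: Zv; apply => _ [b _ <-]; rewrite mxeval_polymap.
  by apply/eqP/negPn/negP/h.
apply: meval_mul_eq0 p1b u => u; rewrite -!mxeval_polymap.
have /ZW[/(_ _ P1p)->|/(_ _ P2p)->] : Z (polymap F u).
- by apply: sub_zariski_closure; exists u.
- by rewrite mulr0.
- by rewrite mul0r.
Qed.

(* The last polynomial is chosen to vanish on Z (l - 1) but not on Z l. *)
Lemma chain_independent X l (Z : nat -> set 'M[K]_(m, n)) : irreducible_chain X l Z ->
  exists f : nat -> {mpoly K[m * n]}, forall Q : {mpoly K[l]},
    (forall v, Z l v -> Q.@[fun i : 'I_l => mxeval (f i) v] = 0) -> Q = 0.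
Proof.
elim: l => [|l IH] [irr lt].
  (* Without variables [Q] is a constant, and [Z 0] has a point. *)
  exists (fun=> 0) => Q Q0; have [_ [[v Zv] _]] := irr 0 isT.
  have QC : Q = (Q@_0%MM)%:MP.
    apply/mpolyP=> a; have -> : a = 0%MM by apply/mnmP; case.
    by rewrite mcoeffC eqxx mulr1.
  by have := Q0 v Zv; rewrite QC mevalC => ->.
have [|f fI] := IH.
  by split=> i il; [apply: irr; rewrite ltnW | apply: lt; rewrite ltnW].
have [g gl gl1] : exists2 g, (forall v, Z l v -> mxeval g v = 0) &
    ~ (forall v, Z l.+1 v -> mxeval g v = 0).
  have [[W1 _ Zl1] _] := irr l.+1 (leqnn _).
  have [[_ [P ->] Zl ] _] := irr l (leqnSn _).
  have [sub nsub] := lt l (leqnn _).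
  have /existsNP[v /not_implyP[v1 v0]] : ~ (Z l.+1 `<=` Z l) := nsub.
  have /existsNP[p /not_implyP[Pp pv]] : ~ (forall p, P p -> mxeval p v = 0).
    by move=> h; apply: v0; rewrite Zl; split=> //; move: v1; rewrite Zl1 => -[].
  exists p; first by rewrite Zl => w [_]; apply.
  by move=> h; apply: pv; apply: h.
exists (fun k => if k == l then g else f k) => Q Q0; apply: muni_eq0.
pose fv v (i : 'I_l) := mxeval (f i) v.
have {Q0} : forall v, Z l.+1 v -> (map_poly (meval (fv v)) (muni Q)).[mxeval g v] = 0.
  move=> v /Q0; rewrite muni_eval /= eqxx => <-; congr (_.[_]).
  apply: eq_map_poly => c; apply: meval_eq => i /=.
  by rewrite ltn_eqF.
(* Write the relation as G X + c in the last variable. On [Z l] the polynomial [g] vanishes, so c =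
   0 by independence; then irreducibility of [Z l.+1] allows division by [g]. *)
elim/poly_ind: (muni Q) => // G c IHG.
have E v : (map_poly (meval (fv v)) (G * 'X + c%:P)).[mxeval g v] =
    (map_poly (meval (fv v)) G).[mxeval g v] * mxeval g v + c.@[fv v].
  by rewrite rmorphD rmorphM /= map_polyX map_polyC /= hornerMXaddC.
move=> h.
have c0 : c = 0.
  apply: fI => v Zv; have [sub _] := lt l (leqnn _).
  by have := h v (sub _ Zv); rewrite E gl // mulr0 add0r.
rewrite {}c0 polyC0 addr0 in h E *.
rewrite IHG ?mul0r //.
pose a := (map_poly (mmap (@mpolyC _ _) (fun i : 'I_l => f i)) G).[g].
have aE v : mxeval a v = (map_poly (meval (fv v)) G).[mxeval g v].
  rewrite /mxeval /a -horner_map /= -map_poly_comp; congr (_.[_]).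
  by apply: eq_map_poly => x /=; rewrite meval_comp.
have [||//] := @zariski_irreducible_mul (Z l.+1) a g (irr _ (leqnn _)).2.
  by move=> v /h; rewrite E meval0 addr0 aE.
by move=> a0 v /a0; rewrite aE.
Qed.

(** A relation between the pullbacks is a polynomial identity on the image of [F], hence on its
    closure. *)
Lemma chain_length_le D (F : 'M[{mpoly K[D]}]_(m, n)) X l (Z : nat -> set 'M[K]_(m, n)) :
  X `<=` zariski_closure (range (polymap F)) -> irreducible_chain X l Z -> (l <= D)%N.
Proof.
move=> XF ch; rewrite leqNgt; apply/negP => Dl.
have [f fI] := chain_independent ch.
have [Q Q0 QF] := alg_dependent (fun i : 'I_l => pullback F (f i)) Dl.
case/eqP: Q0; apply: fI => v Zv.
have {Zv}/XF/zariski_closureP Xv : X v.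
  by have [[W _ Zl] _] := ch.1 l (leqnn _); move: Zv; rewrite Zl => -[].
rewrite -[LHS](meval_comp Q (fun i : 'I_l => f i)).
apply: Xv => _ [u _ <-]; rewrite /mxeval meval_comp.
transitivity ((mmap (@mpolyC D K) (fun i : 'I_l => pullback F (f i)) Q).@[u]); last first.
  by rewrite QF meval0.
by rewrite meval_comp; apply: meval_eq => i; rewrite -mxeval_polymap.
Qed.

(* The hypotheses on g and h say that F u determines the coordinates of
   u near b; they make the chain of images of coordinate flags strict. *)
Lemma param_dimension D (F : 'M[{mpoly K[D]}]_(m, n)) (b : 'I_D -> K)
    (g : 'I_D -> {mpoly K[m * n]}) (h : 'I_D -> {mpoly K[D]}) X :
    (forall j u, mxeval (g j) (polymap F u) = (u j - b j) * (h j).@[u]) ->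
    (forall j, (h j).@[b] != 0) ->
    X = zariski_closure (range (polymap F)) ->
  has_dimension X D.
Proof.
move=> gF hb XF; split; last by move=> l Z; apply: (@chain_length_le _ F); rewrite XF.
(* [c i] freezes the coordinates of index at least [i] at [b]; [Fi i] is [F] restricted to that
   coordinate subspace. *)
pose c i (u : 'I_D -> K) (j : 'I_D) := if (j < i)%N then u j else b j.
pose Fi i : 'M[{mpoly K[D]}]_(m, n) :=
  map_mx (mmap (@mpolyC D K) (fun j : 'I_D => if (j < i)%N then 'X_j else (b j)%:MP)) F.
have FiE i u : polymap (Fi i) u = polymap F (c i u).
  apply/matrixP=> x y; rewrite !mxE meval_comp; apply: meval_eq => j /=.
  by rewrite /c; case: ifP => _; rewrite ?mevalXU ?mevalC.
have sub i j : (i <= j)%N -> zariski_closure (range (polymap (Fi i))) `<=`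
    zariski_closure (range (polymap (Fi j))).
  move=> ij v /zariski_closureP vi; apply/zariski_closureP => p pj.
  apply: vi => _ [u _ <-]; apply: pj; exists (c i u) => //; rewrite !FiE.
  apply/matrixP=> x y; rewrite !mxE; apply: meval_eq => k; rewrite /c.
  by case: ltnP => // jk; rewrite ltnNge (leq_trans ij jk).
have subF i : zariski_closure (range (polymap (Fi i))) `<=`
    zariski_closure (range (polymap F)).
  move=> v /zariski_closureP vi; apply/zariski_closureP => p pj.
  by apply: vi => _ [u _ <-]; apply: pj; exists (c i u); rewrite ?FiE.
exists (fun i => zariski_closure (range (polymap (Fi i)))).
split=> [i _|i iD].
  split; last exact: range_irreducible.
  exists (zariski_closure (range (polymap (Fi i)))); first exact: zariski_closed_closure.
  by apply/seteqP; split=> [v vi|v []] //; split=> //; rewrite XF; apply: subF vi.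
split; first exact: sub.
(* [g j] vanishes on the image of [Fi i], where coordinate [j] is frozen. Equal closures would make
   it vanish on the image of [Fi i.+1], where it is ['X_j] minus [b j] times a factor nonzero at
   [b]. *)
move=> nsub; pose j := Ordinal iD.
have : forall u, ('X_j - (b j)%:MP).@[u] *
    (mmap (@mpolyC D K) (fun k : 'I_D => if (k < i.+1)%N then 'X_k else (b k)%:MP) (h j)).@[u] = 0.
  move=> u; transitivity (mxeval (g j) (polymap (Fi i.+1) u)).
    rewrite FiE gF mevalB mevalXU mevalC {1}/c ltnS leqnn meval_comp; congr (_ * _).
    by apply: meval_eq => k; rewrite /c; case: ifP => _; rewrite ?mevalXU ?mevalC.
  have : zariski_closure (range (polymap (Fi i.+1))) (polymap (Fi i.+1) u).
    by apply: sub_zariski_closure; exists u.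
  move=> /nsub/zariski_closureP; apply => _ [w _ <-].
  by rewrite FiE gF /c ltnn subrr mul0r.
move/(@meval_mul_eq0 _ _ _ b) => /(_ _ (fun=> b j + 1)).
rewrite mevalB mevalXU mevalC [_ + 1]addrC addrK => /(_ _)/eqP; rewrite oner_eq0 => H.
apply: notF; apply: H; rewrite meval_comp.
rewrite (_ : meval _ _ = (h j).@[b]) //; apply: meval_eq => k.
by case: ifP => _; rewrite ?mevalXU ?mevalC.
Qed.

End Dimension.

(** * Orthogonal representations of a forest *)

Section Tree.
Variables (n d : nat) (par : 'I_n -> option 'I_n) (rk : 'I_n -> nat).
Hypothesis par_rk : forall c p, par c = Some p -> (rk p < rk c)%N.

Section Ring.
Variable R : comNzRingType.
Implicit Types (u : 'I_n -> 'rV[R]_d) (A : 'I_n -> 'M[R]_d).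

(** [k] is fuel for a structural recursion. Ranks drop towards the root, so the fuel [(rk c).+1]
    never runs out and the default 0 is not reached. *)
Fixpoint tree_row u A (k : nat) (c : 'I_n) : 'rV[R]_d :=
  if k isn't k'.+1 then 0
  else if par c is Some p then tree_row u A k' p *m A c else u c.

Definition tree u A : 'M[R]_(n, d) := \matrix_c tree_row u A (rk c).+1 c.

Lemma row_tree u A c :
  row c (tree u A) = if par c is Some p then row p (tree u A) *m A c else u c.
Proof.
suff stable k k' x : (rk x < k)%N -> (rk x < k')%N -> tree_row u A k x = tree_row u A k' x.
  rewrite rowK /=; case h : (par c) => [p|//]; rewrite rowK.
  by congr (_ *m _); apply: stable => //; apply: par_rk.
elim: k k' x => [|k IH] [|k'] //= x xk xk'.
case h : (par x) => [p|//]; congr (_ *m _).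
by apply: IH; apply: leq_trans (par_rk h) _.
Qed.

Lemma tree_unique u A w :
    (forall c, row c w = if par c is Some p then row p w *m A c else u c) ->
  w = tree u A.
Proof.
move=> wE; suff h k c : (rk c < k)%N -> row c w = row c (tree u A).
  by apply/row_matrixP => c; apply: h.
elim: k c => // k IH c ck; rewrite wE row_tree.
case h : (par c) => [p|//]; rewrite IH //.
exact: leq_trans (par_rk h) _.
Qed.

(** The antisymmetric matrix of the bivector x ∧ y. *)
Definition alt (x y : 'rV[R]_d) : 'M[R]_d := x^T *m y - y^T *m x.

Lemma trmx_alt x y : (alt x y)^T = - alt x y.
Proof. by rewrite /alt linearB /= !trmx_mul !trmxK opprB. Qed.

Lemma mulmx_alt v x y :
  v *m alt x y = (v *m x^T) 0 0 *: y - (v *m y^T) 0 0 *: x.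
Proof.
by rewrite mulmxBr !mulmxA [v *m x^T]mx11_scalar [v *m y^T]mx11_scalar !mul_scalar_mx !mxE.
Qed.

Lemma mulmx_delta (v : 'rV[R]_d) k : (v *m (delta_mx 0 k : 'rV[R]_d)^T) 0 0 = v 0 k.
Proof. by rewrite trmx_delta -colE mxE. Qed.

Definition param (k0 : 'I_d) (Z : 'M[R]_(n, d)) : 'M[R]_(n, d) :=
  tree (fun c => row c Z) (fun c => alt (delta_mx 0 k0) (row c Z)).

End Ring.

(** This allows trees over polynomial rings to be specialized by evaluation. *)
Lemma map_tree (R R' : comNzRingType) (f : {rmorphism R -> R'})
    (u : 'I_n -> 'rV[R]_d) (A : 'I_n -> 'M[R]_d) :
  map_mx f (tree u A) = tree (fun c => map_mx f (u c)) (fun c => map_mx f (A c)).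
Proof.
apply: tree_unique => c; rewrite -map_row row_tree; case: (par c) => // p.
by rewrite map_mxM map_row.
Qed.

Lemma map_param (R R' : comNzRingType) (f : {rmorphism R -> R'}) k0 (Z : 'M[R]_(n, d)) :
  map_mx f (param k0 Z) = param k0 (map_mx f Z).
Proof.
rewrite map_tree; apply: tree_unique => c; rewrite row_tree; case: (par c) => [p|].
  by rewrite /alt map_mxB !map_mxM -!map_trmx map_delta_mx map_row.
by rewrite map_row.
Qed.

End Tree.

Lemma dotvE (K : fieldType) d (v w : 'rV[K]_d) : dotv v w = (v *m w^T) 0 0.
Proof. by rewrite mxE; apply: eq_bigr => k _; rewrite mxE. Qed.

Lemma dotvC (K : fieldType) d (v w : 'rV[K]_d) : dotv v w = dotv w v.
Proof. by apply: eq_bigr => k _; rewrite mulrC. Qed.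

Lemma dotv_antisym (K : numFieldType) d (v : 'rV[K]_d) (A : 'M[K]_d) :
  A^T = - A -> dotv v (v *m A) = 0.
Proof.
move=> AT; apply/eqP; rewrite -eqNr {1}dotvC !dotvE.
by apply/eqP; rewrite trmx_mul AT mulNmx mulmxN mulmxA [RHS]mxE.
Qed.

(** * The parametrization of V_S *)

Section Representation.
Variables (K : numFieldType) (I : K).
Hypothesis II : I * I = -1.
Variables (n d : nat) (k0 k1 : 'I_d) (e : rel 'I_n) (S : {set 'I_n}).
Hypothesis k01 : k1 != k0.
Variables (par : 'I_n -> option 'I_n) (rk : 'I_n -> nat).
Hypothesis par_edge : forall x y, par x = Some y ->
  [/\ x \in ~: S, y \in ~: S, e x y & (rk y < rk x)%N].
Hypothesis edge_par : forall x y, x \in ~: S -> y \in ~: S -> e x y ->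
  par x = Some y \/ par y = Some x.

Let par_rk c p : par c = Some p -> (rk p < rk c)%N.
Proof. by case/par_edge. Qed.

Local Notation tree := (tree par rk).
Local Notation param := (param par rk k0).

(** Edges outside S join a parent to its child, and v A is orthogonal to v for antisymmetric A.
    Vertices of S have no parent, so their rows are the zero rows of [u]. *)
Lemma tree_OR (u : 'I_n -> 'rV[K]_d) (A : 'I_n -> 'M[K]_d) :
    (forall c, c \in S -> u c = 0) -> (forall c, (A c)^T = - A c) ->
  OR e (tree u A) /\ forall c, c \in S -> row c (tree u A) = 0.
Proof.
move=> uS AT.
have rowS c : c \in S -> row c (tree u A) = 0.
  move=> cS; rewrite row_tree //; case h : (par c) => [p|]; last exact: uS.
  by have [] := par_edge h; rewrite inE cS.
have dot0 v : dotv v (0 : 'rV[K]_d) = 0 by rewrite dotvE trmx0 mulmx0 mxE.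
split=> // i j ij.
have [iS|iS] := boolP (i \in S); first by rewrite (rowS i) // dotvC.
have [jS|jS] := boolP (j \in S); first by rewrite (rowS j).
have [||h|h] := edge_par _ _ ij; rewrite ?inE //.
  by rewrite dotvC [row i _]row_tree // h dotv_antisym.
by rewrite [row j _]row_tree // h dotv_antisym.
Qed.

(** The parameters: the full row of each root outside S, and for each child the vector w normalized
    by a zero [k0]-th entry. *)
Definition free_coords : {set 'I_n * 'I_d} :=
  [set x | (x.1 \notin S) && ((par x.1 == None) || (x.2 != k0))].

Lemma in_free_coords c l :
  ((c, l) \in free_coords) = (c \notin S) && ((par c == None) || (l != k0)).
Proof. by rewrite inE. Qed.

Lemma card_free_coords :
  (#|free_coords| + #|[set x | par x != None]| = d * #|~: S|)%N.
Proof.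
transitivity #|finset.setX (~: S) [set: 'I_d]|; last first.
  by rewrite cardsX cardsT card_ord mulnC.
rewrite -(cardsID free_coords (finset.setX _ _)).
congr (_ + _)%N.
  apply: eq_card => -[c l]; rewrite !inE /=.
  by case: (c \in S); rewrite ?andbF ?andbT.
rewrite -(card_imset [set x | par x != None] (f := fun c => (c, k0))); last by move=> x y [].
apply: eq_card => -[c l]; rewrite !inE /=.
apply/imsetP/idP => [[x]|].
  rewrite inE => px [-> ->]; rewrite eqxx orbF (negbTE px) andbF andbT /=.
  by case h : (par x) px => [p|//] _; have [] := par_edge h; rewrite inE => ->.
case: (c \in S) => //=; rewrite andbT negb_or negbK => /andP[pc /eqP ->].
by exists c; rewrite // inE.
Qed.

Local Notation D := #|free_coords|.

Definition coord_mx (R : comNzRingType) (u : 'I_D -> R) : 'M[R]_(n, d) :=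
  \matrix_(c, l) if [pick j | enum_val j == (c, l)] is Some j then u j else 0.

Lemma coord_mx_val (R : comNzRingType) (u : 'I_D -> R) j c l :
  enum_val j = (c, l) -> coord_mx u c l = u j.
Proof.
move=> jE; rewrite mxE; case: pickP => [i /eqP iE|/(_ j)]; last by rewrite jE eqxx.
by congr u; apply: enum_val_inj; rewrite iE.
Qed.

Lemma coord_mx_out (R : comNzRingType) (u : 'I_D -> R) c l :
  (c, l) \notin free_coords -> coord_mx u c l = 0.
Proof.
move=> cl; rewrite mxE; case: pickP => // i /eqP iE.
by case/negP: cl; rewrite -iE enum_valP.
Qed.

Lemma coord_mxK (R : comNzRingType) (Z : 'M[R]_(n, d)) :
    (forall c l, (c, l) \notin free_coords -> Z c l = 0) ->
  coord_mx (fun j => Z (enum_val j).1 (enum_val j).2) = Z.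
Proof.
move=> Z0; apply/matrixP=> c l.
have [cl|cl] := boolP ((c, l) \in free_coords); last by rewrite coord_mx_out ?Z0.
have jE : enum_val (enum_rank_in cl (c, l)) = (c, l) by rewrite enum_rankK_in.
by rewrite (coord_mx_val _ jE) jE.
Qed.

(* The polynomial map whose image closure is V_S, on the generic point. *)
Definition repr_map : 'M[{mpoly K[D]}]_(n, d) :=
  param (coord_mx (fun j => 'X_j : {mpoly K[D]})).

Lemma polymap_repr (u : 'I_D -> K) : polymap repr_map u = param (coord_mx u).
Proof.
rewrite /polymap /repr_map map_param //; congr param.
by apply/matrixP=> c l; rewrite !mxE; case: pickP => [j|] _ /=; rewrite ?mevalXU ?meval0.
Qed.

(* Isotropic, so that repeating it outside S gives an orthogonal representation. *)
Definition base_row : 'rV[K]_d := delta_mx 0 k0 + I *: delta_mx 0 k1.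

Definition base_pt : 'M[K]_(n, d) := \matrix_c (if c \in S then 0 else base_row).

Definition base_coords : 'M[K]_(n, d) :=
  \matrix_(c, l) if (c, l) \in free_coords then base_row 0 l else 0.

Lemma base_row0 : base_row 0 k0 = 1.
Proof. by rewrite !mxE !eqxx eq_sym (negbTE k01) mulr0 addr0. Qed.

Lemma base_row1 : base_row 0 k1 = I.
Proof. by rewrite !mxE !eqxx (negbTE k01) mulr1 add0r. Qed.

(** For a child, w = I e_k1, and the parent row e_k0 + I e_k1 is sent to I e_k1 - I^2 e_k0, which is
    the same row. *)
Lemma param_base : param base_coords = base_pt.
Proof.
apply/esym/tree_unique => // c; rewrite rowK; case h : (par c) => [p|].
  have [] := par_edge h; rewrite !inE rowK => /negbTE cS /negbTE -> _ _; rewrite cS.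
  have -> : row c base_coords = I *: delta_mx 0 k1.
    apply/rowP=> l; rewrite !mxE in_free_coords cS h /= .
    have [->|] := eqVneq l k0; first by rewrite eq_sym (negbTE k01) mulr0.
    by rewrite /= add0r.
  have dot1 : (base_row *m (I *: delta_mx 0 k1 : 'rV_d)^T) 0 0 = -1.
    by rewrite linearZ /= -scalemxAr mxE mulmx_delta base_row1.
  rewrite mulmx_alt mulmx_delta base_row0 dot1.
  by rewrite scale1r scaleN1r opprK addrC.
apply/rowP=> l; rewrite [RHS]mxE [RHS]mxE in_free_coords h.
by case: (c \in S); rewrite //= mxE.
Qed.

Lemma repr_map_surj w :
    OR e w -> (forall c, c \in S -> row c w = 0) ->
    (forall c, c \notin S -> w c k0 != 0) ->
  exists u, polymap repr_map u = w.
Proof.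
move=> wOR wS wk0.
(* Off [k0] the child's row is the parent's [k0]-th entry times w, hence the division. The remaining
   entry is forced by orthogonality to the parent. *)
pose Z : 'M[K]_(n, d) := \matrix_(c, l)
  if (c, l) \in free_coords then w c l / (if par c is Some p then w p k0 else 1) else 0.
exists (fun j => Z (enum_val j).1 (enum_val j).2).
rewrite polymap_repr coord_mxK; last by move=> c l /negbTE cl; rewrite mxE cl.
apply/esym/tree_unique => // c; case h : (par c) => [p|]; apply/rowP=> l; rewrite mxE.
  have [cS pS ecp _] := par_edge h; rewrite !inE in cS pS.
  have p0 := wk0 p pS.
  rewrite mulmx_alt mulmx_delta !mxE !eqxx /=.
  have [->|lk] := eqVneq l k0; last first.
    by rewrite in_free_coords cS h /= lk mulr0 subr0 mulrCA divff // mulr1.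
  rewrite in_free_coords cS h /= eqxx mulr0 sub0r mulr1.
  have := wOR _ _ ecp; rewrite dotvC /dotv (bigD1 k0) //= !mxE => /eqP.
  rewrite addrC addr_eq0 => /eqP w0.
  rewrite (bigD1 k0) //= !mxE in_free_coords cS h /= eqxx mulr0 add0r.
  apply: (mulfI p0); rewrite -[LHS]opprK -w0 mulrN big_distrr /=; congr (- _).
  apply: eq_bigr => k kk; rewrite !mxE in_free_coords cS h /= kk /=.
  by rewrite mulrCA [w p k0 * _]mulrC divfK // mulrC.
have [cS|cS] := boolP (c \in S); last by rewrite !mxE in_free_coords cS h /= divr1.
by have /rowP/(_ l) := wS c cS; rewrite !mxE in_free_coords cS.
Qed.

(* A = x^T v - v^T x for any x with x . w = 1. *)
Lemma bridge_row (v w : 'rV[K]_d) : w != 0 -> dotv v w = 0 ->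
  exists2 A : 'M[K]_d, A^T = - A & w *m A = v.
Proof.
case/rV0Pn=> k wk vw; exists (alt ((w 0 k)^-1 *: delta_mx 0 k) v).
  exact: trmx_alt.
have w1 : (w *m ((w 0 k)^-1 *: delta_mx 0 k : 'rV_d)^T) 0 0 = 1.
  by rewrite linearZ /= -scalemxAr mxE mulmx_delta mulVf.
rewrite mulmx_alt w1 scale1r.
by rewrite -dotvE dotvC vw scale0r subr0.
Qed.

(** Image points with nonzero [k0]-th entries outside S lie in U(S). The product [Q] of these
    entries is nonzero at the base point, so it can be cancelled from the pullback of [p] times
    [Q]. *)
Lemma range_sub_closure u : zariski_closure (@Uset K n d e S) (polymap repr_map u).
Proof.
apply/zariski_closureP=> p pU; rewrite mxeval_polymap.
pose Q : {mpoly K[D]} := \prod_(c in ~: S) repr_map c k0.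
have QE w : Q.@[w] = \prod_(c in ~: S) polymap repr_map w c k0.
  by rewrite /Q rmorph_prod; apply: eq_bigr => c _; rewrite [RHS]mxE.
apply: (@meval_mul_eq0 _ _ _ Q (fun j => base_coords (enum_val j).1 (enum_val j).2)).
  move=> w; have [Q0|] := eqVneq Q.@[w] 0; first by rewrite Q0 mulr0.
  rewrite QE => /prodf_neq0 Qw; rewrite -mxeval_polymap pU ?mul0r //.
  have [c cS|c|wOR wS] := @tree_OR (fun c => row c (coord_mx w))
      (fun c => alt (delta_mx 0 k0) (row c (coord_mx w))).
  - by apply/rowP=> l; rewrite mxE coord_mx_out ?[in RHS]mxE ?in_free_coords ?cS ?mxE.
  - exact: trmx_alt.
  rewrite -/(param _) -polymap_repr in wOR wS.
  split=> // c; split; last exact: wS.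
  move=> /rowP/(_ k0); rewrite [LHS]mxE [RHS]mxE => c0; apply: contraT => cS.
  by have := Qw c; rewrite inE cS c0 eqxx => /(_ isT).
rewrite QE; apply/prodf_neq0 => c; rewrite inE => cS.
rewrite polymap_repr coord_mxK; last by move=> x l /negbTE xl; rewrite mxE xl.
by rewrite param_base mxE (negbTE cS) base_row0 oner_neq0.
Qed.

Lemma Uset_sub_closure v : @Uset K n d e S v -> zariski_closure (range (polymap repr_map))%classic v.
Proof.
case=> vOR vS; apply/zariski_closureP=> p pF.
have [A0 A0P] : {A0 : 'I_n -> 'M[K]_d & forall c, (A0 c)^T = - A0 c /\
    forall q, par c = Some q -> row q v *m A0 c = row c v}.
  apply: (@choice _ _ (fun c A => A^T = - A /\
    forall q, par c = Some q -> row q v *m A = row c v)) => c.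
  case h : (par c) => [q|]; last by exists 0; split=> //; rewrite trmx0 oppr0.
  have [_ qS ecq _] := par_edge h.
  have [|A AT qA] := @bridge_row (row c v) (row q v) _ (vOR _ _ ecq).
    by apply/eqP => /vS qS'; rewrite inE qS' in qS.
  by exists A; split=> // _ [<-].
pose A1 c := alt (delta_mx 0 k0) (row c base_coords).
(* Antisymmetry is preserved by linear interpolation, so every point of the curve from [v] (t = 0)
   to [base_pt] (t = 1) is an orthogonal representation. *)
pose ut t c := (1 - t) *: row c v + t *: row c base_pt.
pose At t c := (1 - t) *: A0 c + t *: A1 c.
pose lin a b (x y : 'M[K]_(a, b)) : 'M[{poly K}]_(a, b) :=
  (1 - 'X) *: map_mx polyC x + 'X *: map_mx polyC y.
have linE a b (x y : 'M[K]_(a, b)) t :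
    map_mx (horner_eval t) (lin a b x y) = (1 - t) *: x + t *: y.
  by apply/matrixP=> i j; rewrite !mxE /horner_eval !hornerE.
pose G : 'M[{poly K}]_(n, d) :=
  tree (fun c => lin _ _ (row c v) (row c base_pt)) (fun c => lin _ _ (A0 c) (A1 c)).
have GE t : map_mx (horner_eval t) G = tree (ut t) (At t).
  rewrite /G map_tree //; apply: tree_unique => // c; rewrite row_tree //.
  by case: (par c) => [q|]; rewrite linE.
have G0 : map_mx (horner_eval 0) G = v.
  rewrite GE; apply/esym/tree_unique => // c; rewrite /At /ut subr0 !scale1r !scale0r !addr0.
  by case h : (par c) => [q|//]; rewrite (A0P c).2.
have G1 : map_mx (horner_eval 1) G = base_pt.
  rewrite GE -param_base; apply: tree_unique => // c; rewrite row_tree //.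
  rewrite /At /ut subrr !scale1r !scale0r !add0r; case h : (par c) => [//|].
  by rewrite -param_base row_tree // h.
pose P : {poly K} := mmap polyC (fun k => mxvec G ord0 k) p.
have PE t : P.[t] = mxeval p (map_mx (horner_eval t) G).
  by rewrite horner_mmap /mxeval -map_mxvec; apply: meval_eq => k; rewrite mxE.
(* Where [Q] is nonzero the curve lies in the image of [repr_map], so [p] vanishes there. As [Q] is
   nonzero at t = 1, [p] vanishes along the whole curve, in particular at [v]. *)
pose Q : {poly K} := \prod_(c in ~: S) G c k0.
have QE t : Q.[t] = \prod_(c in ~: S) map_mx (horner_eval t) G c k0.
  by rewrite /Q horner_prod; apply: eq_bigr => c _; rewrite [RHS]mxE.
have /eqP : P * Q = 0.
  apply: horner_eq0 => t; rewrite hornerM PE.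
  have [->|] := eqVneq Q.[t] 0; first by rewrite mulr0.
  rewrite QE => /prodf_neq0 Qt; rewrite pF ?mul0r //.
  have [c cS|c|tOR tS] := @tree_OR (ut t) (At t).
  - by rewrite /ut rowK cS (vS c).2 // !scaler0 addr0.
  - by rewrite /At linearD !linearZ /= (A0P c).1 trmx_alt !scalerN opprD.
  have [c cS|u uG] := repr_map_surj tOR tS; last by exists u; rewrite // GE.
  by rewrite -GE; apply: Qt; rewrite inE.
rewrite mulf_eq0 => /orP[] /eqP PQ0; first by rewrite -G0 -PE PQ0 horner0.
have := QE 1; rewrite PQ0 horner0 => /esym/eqP/prodf_eq0[c]; rewrite inE => cS.
by rewrite G1 mxE (negbTE cS) base_row0 oner_eq0.
Qed.

(** * V_S as the closure of a polynomial image, and its dimension *)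

Lemma Vset_range : @Vset K n d e S = zariski_closure (range (polymap repr_map))%classic.
Proof.
apply/seteqP; split=> v /zariski_closureP vP; apply/zariski_closureP=> p pP; apply: vP.
  by move=> x /Uset_sub_closure/zariski_closureP; apply.
by move=> _ [u _ <-]; have /zariski_closureP := range_sub_closure u; apply.
Qed.

Lemma Vset_dimension : has_dimension (@Vset K n d e S) D.
Proof.
pose b (j : 'I_D) := base_coords (enum_val j).1 (enum_val j).2.
pose var x : {mpoly K[n * d]} := 'X_(mxvec_index x.1 x.2).
(* On the image, the entry (c, l) of a child with parent q is u_j times the entry (q, k0).
   Subtracting b_j times that entry leaves (u_j - b_j) times [h j], which is 1 at the base point. *)
pose g (j : 'I_D) : {mpoly K[n * d]} := var (enum_val j) -
  b j *: (if par (enum_val j).1 is Some q then var (q, k0) else 1).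
pose h (j : 'I_D) : {mpoly K[D]} :=
  if par (enum_val j).1 is Some q then repr_map q k0 else 1.
have varE x v : mxeval (var x) v = v x.1 x.2 by rewrite /mxeval mevalXU mxvecE.
apply: (param_dimension (b := b) (g := g) (h := h) _ _ Vset_range).
  move=> j u; rewrite /mxeval mevalB mevalZ -/(mxeval _ _) varE /h.
  case jE : (enum_val j) => [c l] /=.
  have := enum_valP j; rewrite jE in_free_coords => /andP[cS].
  have uE : polymap repr_map u c l = row c (param (coord_mx u)) 0 l.
    by rewrite [RHS]mxE polymap_repr.
  rewrite uE row_tree //; case hp : (par c) => [q|] /=; last first.
    by rewrite !meval1 !mulr1 mxE (coord_mx_val _ jE).
  move=> lk0; rewrite -/(param _) -polymap_repr mulmx_alt mulmx_delta.
  have mE (x y : K) (v w : 'rV_d) : (x *: v - y *: w) 0 l = x * v 0 l - y * w 0 l.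
    by rewrite !mxE.
  have delta0 : (delta_mx 0 k0 : 'rV[K]_d) 0 l = 0 by rewrite mxE (negbTE lk0) andbF.
  have rowZ : row c (coord_mx u) 0 l = u j by rewrite mxE (coord_mx_val _ jE).
  have rowF : row q (polymap repr_map u) 0 k0 = (repr_map q k0).@[u] by rewrite [LHS]mxE [LHS]mxE.
  rewrite -/(mxeval (var (q, k0)) _) varE /= mE delta0 rowZ mulr0 subr0 rowF.
  by rewrite [polymap _ _ _ _]mxE mulrBl mulrC.
move=> j; rewrite /h; case hp : (par _) => [q|]; last by rewrite meval1 oner_neq0.
have -> : (repr_map q k0).@[b] = polymap repr_map b q k0 by rewrite [RHS]mxE.
rewrite polymap_repr coord_mxK; last by move=> x l /negbTE xl; rewrite mxE xl.
have [_ qS _ _] := par_edge hp; rewrite inE in qS.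
by rewrite param_base mxE (negbTE qS) base_row0 oner_neq0.
Qed.

End Representation.

Theorem theorem1 (R : realType) (d n : nat) (hd : (3 <= d)%N) (hn : (1 <= n)%N)
    (e : rel 'I_n) (he : forest e) (S : {set 'I_n}) (hS : admissible e d S) :
  exists D : nat,
    has_dimension (@Vset R[i] n d e S) D /\
    D%:Z = d%:Z * (n%:Z - #|S|%:Z) - #|edges (induced e (~: S))|%:Z.
Proof.
have [par [rk [par_edge edge_par]]] := forest_parent he (~: S).
have d0 : (0 < d)%N by apply: leq_trans hd.
have d1 : (1 < d)%N by apply: leq_trans hd.
(* The first two coordinates carry the isotropic vector (1, i, 0, ...). *)
exists #|free_coords (Ordinal d0) S par|; split.
  by apply: (Vset_dimension (I := 'i) (k1 := Ordinal d1) _ _ par_edge edge_par); rewrite // -expr2 sqrCi.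
have -> : (n%:Z - #|S|%:Z) = #|~: S|%:Z.
  by apply/eqP; rewrite subr_eq addrC -PoszD cardsC card_ord.
rewrite (card_edges_parent par_edge edge_par) -PoszM.
by rewrite -(card_free_coords (Ordinal d0) par_edge) PoszD addrK.
Qed.
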